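(* Let $(Y_n,\mathbf{X}_n)$, $n\in\mathbb{N}$, and $(Y,\mathbf{X})$ be random vectors, where $Y_n$ and $Y$ are non-degenerate square integrable real random variables. Let $Y'$ be a conditionally independent copy of $Y$ relative to $\mathbf{X}$ and let $Y_n'$ be a conditionally independent copy of $Y_n$ relative to $\mathbf{X}_n$. If (i) $(Y_n,Y_n')\to(Y,Y')$ in distribution, and (ii) $\sup_{n\in\mathbb{N}}\mathbb{E}(|Y_n|^{2+\varepsilon})<\infty$ for some $\varepsilon>0$, then $\lim_{n\to\infty}\Lambda(Y_n,\mathbf{X}_n)=\Lambda(Y,\mathbf{X})$.
   Context: For a (non-degenerate) square integrable random variable $Y$ and a random vector $\mathbf{X}$, $\Lambda(Y,\mathbf{X}):=\mathrm{Var}(\mathbb{E}(Y\mid\mathbf{X}))/\mathrm{Var}(Y)$ is the fraction of explained variance of $Y$ given $\mathbf{X}$ (Sobol' index). A random variable $Y'$ is a conditionally independent copy of $Y$ relative to $\mathbf{X}$ if the conditional distribution of $Y'$ given $\mathbf{X}=\mathbf{x}$ equals that of $Y$ given $\mathbf{X}=\mathbf{x}$ for $P^{\mathbf{X}}$-almost all $\mathbf{x}$, and $Y$ and $Y'$ are conditionally independent given $\mathbf{X}$. *)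

(* Defs.v *)
From HB Require Import structures.
From mathcomp Require Import all_boot all_order all_algebra.
From mathcomp Require Import all_classical all_reals all_analysis.

Set Implicit Arguments.
Unset Strict Implicit.
Unset Printing Implicit Defensive.

Import Order.TTheory GRing.Theory Num.Theory.
Import numFieldNormedType.Exports.

Local Open Scope classical_set_scope.
Local Open Scope ring_scope.

Section conditioning.
Context {R : realType} {d : measure_display} {T : measurableType d}.
Context {d' : measure_display} {T' : measurableType d'}.
Variables (P : probability T R) (X : {RV P >-> T'}).

(* [Z] is a version of the conditional expectation of [Y] given [X]; the sets
   [X @^-1` A], with [A] measurable, are exactly the elements of sigma(X) *)
Definition is_condexp (Y Z : T -> R) : Prop :=
  [/\ measurable_fun [set: g_sigma_algebra_preimageType X] Z,
      P.-integrable [set: T] (EFin \o Z) &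
      forall A : set T', measurable A ->
        (\int[P]_(w in X @^-1` A) (Z w)%:E =
         \int[P]_(w in X @^-1` A) (Y w)%:E)%E].

(* Meaningful for integrable [Y], for which a version exists (Radon-Nikodym) and
   is unique up to P-almost sure equality; [cst 0] is only the default value of
   the choice operator [xget] *)
Definition condexp (Y : T -> R) : T -> R := xget (cst 0) (is_condexp Y).

Definition cond_prob (E : set T) : T -> R := condexp (\1_E).

Definition cond_independent (Y Y' : {RV P >-> R}) : Prop :=
  forall A B : set R, measurable A -> measurable B ->
  {ae P, forall w, cond_prob (Y @^-1` A `&` Y' @^-1` B) w =
                   cond_prob (Y @^-1` A) w * cond_prob (Y' @^-1` B) w}.

(* [k x] is (a regular version of) the conditional law of [Y] given X = x *)
Definition is_cond_distribution (Y : {RV P >-> R}) (k : R.-pker T' ~> R) : Prop :=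
  forall (A : set T') (B : set R), measurable A -> measurable B ->
  (P (X @^-1` A `&` Y @^-1` B) = \int[distribution P X]_(x in A) k x B)%E.

(* Regular conditional distributions of real random variables always exist and
   are almost surely unique, so the choice of [k] and [k'] is immaterial *)
Definition same_cond_distribution (Y Y' : {RV P >-> R}) : Prop :=
  exists k k' : R.-pker T' ~> R,
  [/\ is_cond_distribution Y k, is_cond_distribution Y' k' &
      {ae distribution P X, forall x,
         forall B : set R, measurable B -> k x B = k' x B}].

Definition cond_indep_copy (Y Y' : {RV P >-> R}) : Prop :=
  same_cond_distribution Y Y' /\ cond_independent Y Y'.

Definition explained_variance (Y : {RV P >-> R}) : R :=
  fine 'V_P[condexp Y] / fine 'V_P[Y].

End conditioning.

Arguments cond_indep_copy {R d T d' T'} P X Y Y'.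
Arguments explained_variance {R d T d' T'} P X Y.

Definition nondegenerate_RV {R : realType} {d : measure_display}
    {T : measurableType d} (P : probability T R) (Y : {RV P >-> R}) : Prop :=
  ~ exists c : R, {ae P, forall w, Y w = c}.

Arguments nondegenerate_RV {R d T} P Y.

(* The random elements may live on different probability spaces *)
Definition cvg_in_distribution {R : realType} {S : topologicalType}
    {dn : nat -> measure_display} {Tn : forall n, measurableType (dn n)}
    (Pn : forall n, probability (Tn n) R) (Zn : forall n, Tn n -> S)
    {d : measure_display} {T : measurableType d}
    (P : probability T R) (Z : T -> S) : Prop :=
  forall f : S -> R, continuous f -> (exists M : R, forall s, `|f s| <= M) ->
  'E_(Pn n)[f \o Zn n]%E @[n --> \oo] --> 'E_P[f \o Z]%E.

Arguments cvg_in_distribution {R S dn Tn} Pn Zn {d T} P Z.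

(* Main.v *)
(** If [Y'] is a conditionally independent copy of [Y] given [X], then
    E(Y Y') = E(E(Y|X)^2), hence
      Lambda(Y,X) = (E(Y Y') - (E Y)^2) / (E(Y^2) - (E Y)^2),
    which depends only on the law of (Y,Y').  The three expectations are those
    of the continuous functions y y', y^2 and y; the bound on the moments of
    order 2+e bounds their moments of order 1+e/2, so they are uniformly
    integrable and truncation lets convergence in distribution pass to the
    limit.  The denominator has a nonzero limit because [Y] is non-degenerate.

    The identity E(Y Y') = E(E(Y|X)^2) holds for simple functions of [Y] and
    [Y'] by conditional independence, the conditional law [k x] of [Y] given
    X = x being also that of [Y'], and extends to [Y] by dominated convergence,
    the dominating function on the right being the conditional second moment
    of [Y]. *)

Require Import Defs.
From HB Require Import structures.
From mathcomp Require Import all_boot all_order all_algebra.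
From mathcomp Require Import finmap.
From mathcomp Require Import all_classical all_reals all_analysis.
From mathcomp Require Import measurable_realfun ring lra.

Import Order.TTheory GRing.Theory Num.Theory.
Import numFieldNormedType.Exports.

Local Open Scope classical_set_scope.
Local Open Scope ring_scope.

Set Implicit Arguments.
Unset Strict Implicit.
Unset Printing Implicit Defensive.

Import HBSimple HBNNSimple.

(** * Versions of conditional expectation: almost sure uniqueness and existence *)

Section condexp_theory.
Context {R : realType} {d : measure_display} {T : measurableType d}.
Context {d' : measure_display} {T' : measurableType d'}.
Variables (P : probability T R) (X : {RV P >-> T'}).
Local Open Scope ereal_scope.

(* Pushing [P] forward along this map makes almost sure uniqueness with respect
   to sigma(X) an instance of [integral_ae_eq]. *)
Definition to_sigma_RV (w : T) : g_sigma_algebra_preimageType X := w.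

Lemma measurable_to_sigma_RV : measurable_fun [set: T] to_sigma_RV.
Proof. by move=> _ B [A mA <-]; rewrite !setTI; exact: measurable_funPTI. Qed.

HB.instance Definition _ := isMeasurableFun.Build _ _ T
  (g_sigma_algebra_preimageType X) to_sigma_RV measurable_to_sigma_RV.

Lemma is_condexp_measurable (Y Z : T -> R) :
  is_condexp X Y Z -> measurable_fun [set: T] Z.
Proof. by move=> [mZ _ _]; exact: measurableT_comp mZ measurable_to_sigma_RV. Qed.

Lemma is_condexp_ae_unique (Y Z1 Z2 : T -> R) :
  is_condexp X Y Z1 -> is_condexp X Y Z2 -> {ae P, forall w, Z1 w = Z2 w}.
Proof.
move=> [mZ1 iZ1 Z1E] [mZ2 iZ2 Z2E].
pose Q := distribution P to_sigma_RV.
have iQ1 : Q.-integrable setT (EFin \o Z1).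
  apply: integrable_pushforward => //.
  exact/measurable_EFinP.
have : ae_eq Q setT (EFin \o Z1) (EFin \o Z2).
  apply: integral_ae_eq => //.
    exact/measurable_EFinP.
  move=> E _ mE; case: (mE) => A mA AE.
  have mE' : measurable (to_sigma_RV @^-1` E) by exact: measurable_funPTI.
  rewrite /Q /distribution !integral_pushforward//=.
  - by move: AE; rewrite setTI => <-; rewrite [LHS]Z1E// [RHS]Z2E.
  - exact/measurable_EFinP.
  - exact: integrableS iZ2.
  - exact/measurable_EFinP.
  - exact: integrableS iZ1.
(* [to_sigma_RV] is the identity on points, so a null set of [Q] is also [P]-null. *)
move=> [N [mN QN0 subN]]; exists (to_sigma_RV @^-1` N); split => //.
- exact: measurable_funPTI.
- by move=> w /= Zw; apply: subN => /= /(_ I)[].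
Qed.

Lemma condexp_ae (Y Z : T -> R) : is_condexp X Y Z ->
  {ae P, forall w, condexp X Y w = Z w}.
Proof.
move=> YZ; apply: (is_condexp_ae_unique (Y := Y)) => //.
by rewrite /condexp; case: xgetP => // /(_ Z).
Qed.

Lemma is_condexp_condexp (Y Z : T -> R) : is_condexp X Y Z ->
  is_condexp X Y (condexp X Y).
Proof. by move=> YZ; rewrite /condexp; case: xgetP => // /(_ Z). Qed.

(** Composition with [X] gives sigma(X)-measurability, and a change of variables reduces the
    averaging identity to integrals against the law of [X]. *)
Lemma is_condexp_comp (Y : T -> R) (g : T' -> R) :
  measurable_fun setT g -> (distribution P X).-integrable setT (EFin \o g) ->
  (forall A, measurable A ->
    \int[distribution P X]_(x in A) (g x)%:E = \int[P]_(w in X @^-1` A) (Y w)%:E) ->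
  is_condexp X Y (g \o X).
Proof.
move=> mg ig gE; have ig' : P.-integrable setT (EFin \o (g \o X)).
  move/integrableP : ig => [_ ig].
  apply/integrableP; split; first exact/measurable_EFinP/measurableT_comp.
  rewrite (le_lt_trans _ ig)// /distribution ge0_integral_pushforward//.
  by apply: measurableT_comp => //; exact/measurable_EFinP.
split => //.
- move=> _ B mB; exists (g @^-1` B) => //.
  by rewrite -(setTI (_ @^-1` _)); exact: mg.
- move=> A mA; rewrite -gE// /distribution integral_pushforward//.
    exact/measurable_EFinP.
  apply: integrableS ig' => //; exact: measurable_funPTI.
Qed.

(** Radon-Nikodym: the set function A |-> P(X in A, E) is a finite measure dominated by the law of
    [X], and its density composed with [X] is a version. *)
Lemma is_cond_prob_exists (E : set T) : measurable E ->
  exists Z, is_condexp X \1_E Z.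
Proof.
move=> mE.
have [nu nuE] : exists nu : {finite_measure set T' -> \bar R},
    forall A, nu A = P (X @^-1` A `&` E).
  have nufin : fin_num_fun (pushforward (mrestr P mE) X).
    by move=> A mA; rewrite fin_num_measure//; exact: measurable_funPTI.
  pose nu : {finite_measure set T' -> \bar R} :=
    HB.pack (pushforward (mrestr P mE) X) (Measure_isFinite.Build _ _ _ _ nufin).
  (* The measure structure of a pushforward depends on the measurability of the map; the arguments
     [mX] discharge these obligations. *)
  by have mX := measurable_funPT X; exists (nu mX mX mX mX).
have : nu `<< distribution P X.
  apply/null_content_dominatesP => A mA.
  rewrite /distribution /pushforward /= => PA0.
  apply/eqP; rewrite nuE -measure_le0 -PA0 le_measure// ?inE//.
    by apply: measurableI => //; exact: measurable_funPTI.
  exact: measurable_funPTI.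
move=> /radon_nikodym_sigma_finite[f [f0 ffin fi fE]].
have mf : measurable_fun setT f by exact: measurable_int fi.
exists ((fine \o f) \o X).
apply: is_condexp_comp.
- exact: measurableT_comp.
- by apply: eq_integrable fi => // x _ /=; rewrite fineK.
- move=> A mA.
  under eq_integral do rewrite fineK//.
  rewrite -fE//= integral_indic//; last exact: measurable_funPTI.
  by rewrite setIC nuE.
Qed.
End condexp_theory.

(** * Integration against mixtures of measures *)

Section disintegration.
Context d1 d2 (T1 : measurableType d1) (T2 : measurableType d2) (R : realType).
Local Open Scope ereal_scope.

Section kernel_cst.
Variable m : {finite_measure set T1 -> \bar R}.

(** Read as a kernel from the one-point space, [m] can be composed with [k], so that a mixture
    becomes a composite kernel. *)
Definition kernel_cst (_ : unit) : {measure set T1 -> \bar R} := m.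

Let measurable_kernel_cst U : measurable U ->
  measurable_fun [set: unit] (kernel_cst ^~ U).
Proof. by move=> _; exact: measurable_cst. Qed.

HB.instance Definition _ :=
  @isKernel.Build _ _ _ _ _ kernel_cst measurable_kernel_cst.

Let kernel_cst_uub : measure_fam_uub kernel_cst.
Proof.
(* The uniform bound has to be strict, hence the added 1. *)
exists (fine (m setT) + 1)%R => x.
by rewrite EFinD fineK ?fin_num_measure// lteDl ?fin_num_measure// lte01.
Qed.

HB.instance Definition _ :=
  @Kernel_isFinite.Build _ _ _ _ _ kernel_cst kernel_cst_uub.

End kernel_cst.

Lemma ge0_integral_mixture (m : {finite_measure set T1 -> \bar R})
    (k : R.-pker T1 ~> T2) (nu : {measure set T2 -> \bar R}) :
  (forall B, measurable B -> nu B = \int[m]_x k x B) ->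
  forall f, (forall y, 0 <= f y) -> measurable_fun setT f ->
  \int[nu]_y f y = \int[m]_x \int[k x]_y f y.
Proof.
move=> nuE f f0 mf.
(* [kernel.kernel_snd] turns [k] into a kernel on pairs that ignores the point of [unit], the form
   that [mkcomp] composes. *)
transitivity (\int[mkcomp (kernel_cst m) (kernel.kernel_snd k) tt]_y f y).
  by apply: eq_measure_integral => B mB _; rewrite nuE.
exact: integral_kcomp.
Qed.

Lemma ge0_integral_mrestr (m : {finite_measure set T1 -> \bar R})
    (A : set T1) (mA : measurable A) f : (forall x, 0 <= f x) ->
  measurable_fun setT f ->
  \int[mrestr m mA]_x f x = \int[m]_(x in A) f x.
Proof.
move=> f0 mf.
rewrite (@ge0_negligible_integral _ _ _ _ _ (~` A))//; first last.
- by rewrite /= /mrestr setICl measure0.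
- exact: measurableC.
rewrite setTD setCK; apply: eq_measure_integral => B mB BA.
by rewrite /= /mrestr setIidl.
Qed.

Lemma ge0_integral_mixture_in (m : {finite_measure set T1 -> \bar R})
    (k : R.-pker T1 ~> T2) (nu : {measure set T2 -> \bar R}) A :
  measurable A -> (forall B, measurable B -> nu B = \int[m]_(x in A) k x B) ->
  forall f, (forall y, 0 <= f y) -> measurable_fun setT f ->
  \int[nu]_y f y = \int[m]_(x in A) \int[k x]_y f y.
Proof.
move=> mA nuE f f0 mf.
rewrite -(ge0_integral_mrestr _ mA); last 2 first.
- by move=> x; exact: integral_ge0.
- apply: measurable_fun_integral_kernel => // U mU; exact: measurable_kernel.
apply: ge0_integral_mixture => // B mB.
rewrite nuE// ge0_integral_mrestr//; exact: measurable_kernel.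
Qed.

End disintegration.

(** * Joint law of a variable and its conditionally independent copy *)

Section joint_law.
Context {R : realType} {d : measure_display} {T : measurableType d}.
Context {d' : measure_display} {T' : measurableType d'}.
Variables (P : probability T R) (X : {RV P >-> T'}).
Local Open Scope ereal_scope.

Lemma measurable_fine_kernel (k : R.-pker T' ~> R) B : measurable B ->
  measurable_fun setT (fun x => fine (k x B)).
Proof. by move=> mB; apply: measurableT_comp => //; exact: measurable_kernel. Qed.

Lemma kernel_le1 (k : R.-pker T' ~> R) x B : measurable B -> k x B <= 1.
Proof. by move=> mB; rewrite -(@prob_kernel _ _ _ _ _ k x) le_measure// inE. Qed.

Lemma fineK_kernel (k : R.-pker T' ~> R) x B : measurable B ->
  (fine (k x B))%:E = k x B.
Proof.
move=> mB; rewrite fineK// ge0_fin_numE//.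
by rewrite (le_lt_trans (kernel_le1 k x mB))// ltry.
Qed.

Lemma fine_kernel_le1 (k : R.-pker T' ~> R) x B : measurable B ->
  (`|fine (k x B)| <= 1)%R.
Proof.
by move=> mB; rewrite ger0_norm ?fine_ge0// -lee_fin fineK_kernel// kernel_le1.
Qed.

Lemma probability_bounded_integrable d0 (T0 : measurableType d0)
    (Q : probability T0 R) (f : T0 -> R) M :
  measurable_fun setT f -> (forall x, (`|f x| <= M)%R) ->
  Q.-integrable setT (EFin \o f).
Proof.
move=> mf fM; apply: (@le_integrable _ _ _ Q setT measurableT _ (cst M%:E)).
- exact/measurable_EFinP.
- move=> x _; rewrite /= lee_fin (le_trans (fM x))//.
  exact: ler_norm.
- exact: finite_measure_integrable_cst.
Qed.

(** For fixed [B], the identity defining a conditional distribution is the one defining a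
    conditional probability. *)
Lemma is_cond_prob_kernel (Y : {RV P >-> R}) (k : R.-pker T' ~> R) B :
  is_cond_distribution X Y k -> measurable B ->
  is_condexp X \1_(Y @^-1` B) ((fun x => fine (k x B)) \o X).
Proof.
move=> kY mB; apply: is_condexp_comp.
- exact: measurable_fine_kernel.
- apply: (@probability_bounded_integrable _ _ _ _ 1%R).
    exact: measurable_fine_kernel.
  by move=> x; exact: fine_kernel_le1.
- move=> A mA.
  under eq_integral do rewrite fineK_kernel//.
  rewrite -kY// integral_indic; [by rewrite setIC| |]; exact: measurable_funPTI.
Qed.

(** Integrate the conditional independence identity over the whole space, after replacing the
    conditional probabilities almost surely by values of a single kernel common to [Y] and [Y']. *)
Lemma cond_indep_copy_joint_law (Y Y' : {RV P >-> R}) :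
  cond_indep_copy P X Y Y' -> exists k : R.-pker T' ~> R,
  [/\ is_cond_distribution X Y k, is_cond_distribution X Y' k &
    forall A B, measurable A -> measurable B ->
      P (Y @^-1` A `&` Y' @^-1` B) =
      \int[distribution P X]_x (fine (k x A) * fine (k x B))%:E].
Proof.
move=> [[k [k' [kY k'Y kk']]] YY'].
have kY' : is_cond_distribution X Y' k.
  move=> A B mA mB; rewrite k'Y//; apply: ae_eq_integral => //.
  - exact/measurable_funTS/measurable_kernel.
  - exact/measurable_funTS/measurable_kernel.
  - by apply: filterS kk' => x kk' _; rewrite kk'.
exists k; split => // A B mA mB.
have mE : measurable (Y @^-1` A `&` Y' @^-1` B).
  by apply: measurableI; exact: measurable_funPTI.
(* [condexp] falls back to 0 when no version exists, so one is exhibited before the averaging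
   identity is used over the whole space. *)
have [Z /is_condexp_condexp EZ] := is_cond_prob_exists X mE.
have mfkAB : measurable_fun setT (fun x => fine (k x A) * fine (k x B))%R.
  by apply: measurable_funM; exact: measurable_fine_kernel.
have [_ _ /(_ setT measurableT)] := EZ.
rewrite preimage_setT integral_indic// setIT => <-.
rewrite /distribution integral_pushforward//; last 2 first.
  exact/measurable_EFinP.
- apply: (@probability_bounded_integrable _ _ _ _ 1%R).
    exact: measurableT_comp mfkAB _.
  by move=> w; rewrite normrM mulr_ile1// fine_kernel_le1.
apply: ae_eq_integral => //.
- exact/measurable_EFinP/is_condexp_measurable/EZ.
- exact/measurable_EFinP/(measurableT_comp mfkAB).
have := condexp_ae (is_cond_prob_kernel kY mA).
have := condexp_ae (is_cond_prob_kernel kY' mB).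
have := YY' A B mA mB.
apply: filterS3 => w; rewrite /cond_prob => -> -> -> _ //.
Qed.

End joint_law.

(** * Integrals and second moments under a probability *)

Section probability_integral.
Context {R : realType} {d : measure_display} {T : measurableType d}.
Variable Q : probability T R.
Local Open Scope ereal_scope.

Lemma integral_lincomb (I : eqType) (s : seq I) (c : I -> R) (F : I -> T -> R) :
  (forall i, measurable_fun setT (F i)) ->
  (forall i x, (`|F i x| <= 1)%R) ->
  \int[Q]_x (\sum_(i <- s) c i * F i x)%:E =
  \sum_(i <- s) (c i)%:E * \int[Q]_x (F i x)%:E.
Proof.
move=> mF F1.
have iF i : Q.-integrable setT (EFin \o F i).
  exact: probability_bounded_integrable (F1 i).
under eq_integral do rewrite -sumEFin.
rewrite integral_sum => [|//|i]; last exact: (integrableZl measurableT (c i) (iF i)).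
by apply: eq_bigr => i _; rewrite -(integralZl measurableT (iF i)).
Qed.

Lemma Lfun2_of_sqr (f : T -> R) : measurable_fun setT f ->
  \int[Q]_x (f x ^+ 2)%:E < +oo -> f \in Lfun Q 2%:E.
Proof.
move=> mf f2; rewrite inE; apply/andP; split; rewrite inE//=.
rewrite /finite_norm unlock poweR_lty//; apply: le_lt_trans f2.
by under eq_integral do rewrite /= powR_mulrn// real_normK ?num_real//.
Qed.

(** Nonnegativity of the variance when the second moment is finite; otherwise the right-hand side is
    infinite. *)
Lemma sqr_mean_le_mean_sqr (f : T -> R) : measurable_fun setT f ->
  (fine (\int[Q]_x (f x)%:E) ^+ 2)%:E <= \int[Q]_x (f x ^+ 2)%:E.
Proof.
move=> mf; have [->|foo] := eqVneq (\int[Q]_x (f x ^+ 2)%:E) +oo.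
  by rewrite leey.
have f2 : f \in Lfun Q 2%:E by rewrite Lfun2_of_sqr// ltey.
have f1 : f \in Lfun Q 1 by rewrite Lfun_subset12 ?fin_num_measure.
have := variance_ge0 Q f.
have := expectation_fin_num f1.
by rewrite varianceE// unlock => ffin; rewrite sube_ge0 ?EFin_expe ?fineK// fin_numX.
Qed.

End probability_integral.

(** * Means under a conditional law *)

Section kernel_mean.
Context {R : realType} {d' : measure_display} {T' : measurableType d'}.
Variable k : R.-pker T' ~> R.
Local Open Scope ereal_scope.

(* The library does not equip the values of a probability kernel with a
   probability structure; this copy of [k x] carries it. *)
Definition kernel_law (x : T') : set R -> \bar R := k x.

HB.instance Definition _ x := Measure.copy (kernel_law x) (k x).
HB.instance Definition _ x := Measure_isProbability.Build _ _ _
  (kernel_law x) (prob_kernel x).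

(* [fine] makes this 0 when the integral is infinite. *)
Definition kernel_mean (f : R -> R) (x : T') : R :=
  fine (\int[kernel_law x]_y (f y)%:E).

Lemma measurable_kernel_mean f : measurable_fun setT f ->
  measurable_fun setT (kernel_mean f).
Proof.
move=> mf; apply: measurableT_comp => //.
(* Kernel integrals of nonnegative functions are measurable in the parameter, hence the split into
   positive and negative parts. *)
under eq_fun do rewrite integralE.
apply: emeasurable_funB; apply: measurable_fun_integral_kernel => //.
- by move=> U mU; exact: measurable_kernel.
- exact/measurable_funepos/measurable_EFinP.
- by move=> U mU; exact: measurable_kernel.
- exact/measurable_funeneg/measurable_EFinP.
Qed.

Lemma kernel_mean_sfun (f : {sfun R >-> R}) x : kernel_mean f x =
  (\sum_(r <- fset_set (range f)) r * fine (k x (f @^-1` [set r])))%R.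
Proof.
rewrite /kernel_mean.
under eq_integral do rewrite fimfunE fsbig_finite//=.
have mf r : measurable (f @^-1` [set r]) by [].
rewrite integral_lincomb; first last.
- by move=> r y; rewrite indicE; case: (_ \in _); rewrite ?normr1 ?normr0.
- by move=> r; exact: measurable_indic.
transitivity (fine (\sum_(r <- fset_set (range f))
    (r * fine (k x (f @^-1` [set r])))%:E)); last by rewrite sumEFin.
congr fine; apply: eq_bigr => r _.
by rewrite integral_indic// setIT EFinM fineK_kernel.
Qed.

End kernel_mean.

(** * The product moment of simple functions, and simple approximation of the identity *)

Section product_moment.
Context {R : realType} {d : measure_display} {T : measurableType d}.
Context {d' : measure_display} {T' : measurableType d'}.
Variables (P : probability T R) (X : {RV P >-> T'}) (Y Y' : {RV P >-> R}).
Variable k : R.-pker T' ~> R.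
Local Open Scope ereal_scope.
Hypothesis YY'k : forall A B, measurable A -> measurable B ->
  P (Y @^-1` A `&` Y' @^-1` B) =
  \int[distribution P X]_x (fine (k x A) * fine (k x B))%:E.

(** Both sides expand into sums over pairs of values of [f], and the joint law on rectangles matches
    them term by term. *)
Lemma sfun_product_moment (f : {sfun R >-> R}) :
  \int[P]_w (f (Y w) * f (Y' w))%:E =
  \int[distribution P X]_x (kernel_mean k f x ^+ 2)%:E.
Proof.
pose s := [seq (r, t) | r <- fset_set (range f), t <- fset_set (range f)].
pose A r := f @^-1` [set r].
have mA r : measurable (A r) by rewrite /A.
have LE w : (f (Y w) * f (Y' w) = \sum_(p <- s) p.1 * p.2 *
    \1_(Y @^-1` A p.1 `&` Y' @^-1` A p.2) w)%R.
  rewrite /s big_allpairs !fimfunE !fsbig_finite//= mulr_suml; apply: eq_bigr => r _.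
  rewrite mulr_sumr; apply: eq_bigr => t _.
  by rewrite indicI mulrACA.
have RE x : (kernel_mean k f x ^+ 2 = \sum_(p <- s) p.1 * p.2 *
    (fine (k x (A p.1)) * fine (k x (A p.2))))%R.
  rewrite /s big_allpairs kernel_mean_sfun expr2 mulr_suml; apply: eq_bigr => r _.
  by rewrite mulr_sumr; apply: eq_bigr => t _; rewrite mulrACA.
under eq_integral do rewrite LE.
under [RHS]eq_integral do rewrite RE.
have mYA p : measurable (Y @^-1` A p.1 `&` Y' @^-1` A p.2).
  by apply: measurableI; exact: measurable_funPTI.
rewrite [LHS]integral_lincomb; first last.
- by move=> p y; rewrite indicE; case: (_ \in _); rewrite ?normr1 ?normr0.
- by move=> p; exact: measurable_indic.
rewrite [RHS]integral_lincomb; first last.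
- by move=> p x; rewrite normrM mulr_ile1// fine_kernel_le1.
- by move=> p; apply: measurable_funM; exact: measurable_fine_kernel.
by apply: eq_bigr => p _; rewrite -YY'k// integral_indic// setIT.
Qed.

End product_moment.

(** Approximate the positive and negative parts from below and subtract. At each point one of the
    parts vanishes, which yields the domination by |y|. *)
Lemma sfun_approx_id (R : realType) : exists s : {sfun R >-> R}^nat,
  (forall y, s n y @[n --> \oo] --> y) /\ (forall n y, `|s n y| <= `|y|).
Proof.
have mp : measurable_fun [set: R] (fun y : R => (Num.max y 0)%:E).
  by apply/measurable_EFinP/measurable_maxr.
have mn : measurable_fun [set: R] (fun y : R => (Num.max (- y) 0)%:E).
  by apply/measurable_EFinP/measurable_maxr => //; exact: measurable_funN.
have p0 (y : R) : [set: R] y -> (0 <= (Num.max y 0)%:E)%E.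
  by rewrite lee_fin le_max lexx orbT.
have n0 (y : R) : [set: R] y -> (0 <= (Num.max (- y) 0)%:E)%E.
  by rewrite lee_fin le_max lexx orbT.
pose p := nnsfun_approx measurableT mp; pose q := nnsfun_approx measurableT mn.
exists (fun n => (p n : {sfun R >-> R}) - (q n : {sfun R >-> R})); split => [y|n y].
  have {2}-> : y = Num.max y 0 - Num.max (- y) 0.
    by case: (leP y 0); case: (leP (- y) 0); lra.
  apply: cvgB.
  - by have /fine_cvgP[] := cvg_nnsfun_approx measurableT mp p0 (x:=y) I.
  - by have /fine_cvgP[] := cvg_nnsfun_approx measurableT mn n0 (x:=y) I.
rewrite sfunB /=.
have : p n y <= Num.max y 0.
  rewrite -lee_fin /p nnsfun_approxE; exact: le_approx.
have : q n y <= Num.max (- y) 0.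
  rewrite -lee_fin /q nnsfun_approxE; exact: le_approx.
have : 0 <= p n y by [].
have : 0 <= q n y by [].
by case: (leP y 0); case: (leP (- y) 0); case: (ler0P y); rewrite ler_norml; lra.
Qed.

(** * Conditional second moments and the product moment E(Y Y') *)

Section second_moment.
Context {R : realType} {d : measure_display} {T : measurableType d}.
Context {d' : measure_display} {T' : measurableType d'}.
Variables (P : probability T R) (X : {RV P >-> T'}).
Variable k : R.-pker T' ~> R.
Local Open Scope ereal_scope.

(** The image under [Y] of [P] restricted to the event X in A is the mixture of the laws [k x] over
    [A]. *)
Lemma ge0_integral_cond_distribution (Y : {RV P >-> R}) A (f : R -> \bar R) :
  is_cond_distribution X Y k -> measurable A ->
  (forall y, 0 <= f y) -> measurable_fun setT f ->
  \int[P]_(w in X @^-1` A) f (Y w) =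
  \int[distribution P X]_(x in A) \int[kernel_law k x]_y f y.
Proof.
move=> kY mA f0 mf.
have mXA : measurable (X @^-1` A) by exact: measurable_funPTI.
rewrite -(ge0_integral_mrestr P mXA); last 2 first.
- by move=> w; exact: f0.
- exact: measurableT_comp mf _.
transitivity (\int[pushforward (mrestr P mXA) Y]_y f y).
  by rewrite ge0_integral_pushforward.
apply: (@ge0_integral_mixture_in _ _ _ _ _ _ k) => // B mB.
by rewrite -kY//= /pushforward /mrestr /= setIC.
Qed.

Lemma ge0_integral_cond_distributionT (Y : {RV P >-> R}) (f : R -> \bar R) :
  is_cond_distribution X Y k ->
  (forall y, 0 <= f y) -> measurable_fun setT f ->
  \int[P]_w f (Y w) = \int[distribution P X]_x \int[kernel_law k x]_y f y.
Proof.
move=> kY f0 mf.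
by rewrite -(ge0_integral_cond_distribution kY measurableT f0 mf) preimage_setT.
Qed.

Variable Y : {RV P >-> R}.
Hypotheses (kY : is_cond_distribution X Y k).
Hypothesis (Y2 : (Y : T -> R) \in Lfun P 2%:E).

(** The conditional second moment of [Y] given X = x, possibly infinite at some points. *)
Let G x := \int[kernel_law k x]_y (y ^+ 2)%:E.

Let msqr : measurable_fun [set: R] (fun y : R => (y ^+ 2)%:E).
Proof. by apply/measurable_EFinP; exact: exprn_measurable. Qed.

(** By disintegration the integral of [G] is E(Y^2). *)
Lemma integrable_cond_second_moment : (distribution P X).-integrable setT G.
Proof.
apply/integrableP; split.
  apply: measurable_fun_integral_kernel => //.
  - by move=> U mU; exact: measurable_kernel.
  - by move=> y; rewrite lee_fin sqr_ge0.
have G0 x : 0 <= G x by apply: integral_ge0 => y _; rewrite lee_fin sqr_ge0.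
under eq_integral do rewrite gee0_abs//.
rewrite -(ge0_integral_cond_distributionT kY)//; last first.
  by move=> y; rewrite lee_fin sqr_ge0.
have /integrableP[_] := Lfun2_integrable_sqr Y2; apply: le_lt_trans.
by under [leRHS]eq_integral do rewrite /= ger0_norm ?sqr_ge0//.
Qed.

Lemma id_Lfun2_kernel x : G x < +oo -> (id : R -> R) \in Lfun (kernel_law k x) 2%:E.
Proof. by move=> Gx; apply: Lfun2_of_sqr. Qed.

Lemma id_integrable_kernel x : G x < +oo ->
  (kernel_law k x).-integrable setT (EFin : R -> \bar R).
Proof.
move=> Gx; apply/(Lfun1_integrable _ (id : R -> R)).
by rewrite Lfun_subset12 ?fin_num_measure// id_Lfun2_kernel.
Qed.

(** Jensen's inequality for the square. The bound does not depend on [f], so [G] dominates all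
    simple approximations at once, as well as the conditional mean itself. *)
Lemma kernel_mean_sqr_le x (f : R -> R) : measurable_fun setT f ->
  (forall y, `|f y| <= `|y|)%R -> (kernel_mean k f x ^+ 2)%:E <= G x.
Proof.
move=> mf fy; rewrite (le_trans (sqr_mean_le_mean_sqr _ mf))//.
apply: ge0_le_integral => //.
- by move=> y _; rewrite lee_fin sqr_ge0.
- exact/measurable_EFinP/measurable_funX.
- move=> y _; rewrite lee_fin -[leLHS]real_normK ?num_real//.
  by rewrite -[leRHS]real_normK ?num_real// lerXn2r ?nnegrE.
Qed.

Lemma cond_second_moment_fin_ae : {ae distribution P X, forall x, G x < +oo}.
Proof.
have := integrable_ae measurableT integrable_cond_second_moment.
by apply: filterS => x /(_ I) Gx; rewrite ltey_eq Gx.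
Qed.

Lemma product_moment (Y' : {RV P >-> R}) : is_cond_distribution X Y' k ->
  (Y' : T -> R) \in Lfun P 2%:E ->
  (forall A B, measurable A -> measurable B ->
  P (Y @^-1` A `&` Y' @^-1` B) =
  \int[distribution P X]_x (fine (k x A) * fine (k x B))%:E) ->
  \int[P]_w (Y w * Y' w)%:E =
  \int[distribution P X]_x (kernel_mean k id x ^+ 2)%:E.
Proof.
move=> kY' Y'2 YY'k.
have [s [scvg sle]] := sfun_approx_id R.
have LHS : \int[P]_w (s n (Y w) * s n (Y' w))%:E @[n --> \oo]
    --> \int[P]_w (Y w * Y' w)%:E.
  have [] := @dominated_convergence _ _ _ P setT measurableT
    (fun n w => (s n (Y w) * s n (Y' w))%:E) (fun w => (Y w * Y' w)%:E)
    (fun w => `|(Y w * Y' w)%:E|) => //.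
  - move=> n; apply/measurable_EFinP/measurable_funM; exact: measurableT_comp.
  - exact/measurable_EFinP/measurable_funM.
  - apply: aeW => w _; apply/cvg_EFin; first exact: nearW.
    exact: cvgM.
  - apply: integrable_abse.
    exact/Lfun1_integrable/(Lfun2_mul_Lfun1 Y2 Y'2).
  - by apply: aeW => w n _; rewrite lee_fin !normrM ler_pM.
have RHS : \int[distribution P X]_x (kernel_mean k (s n) x ^+ 2)%:E @[n --> \oo]
    --> \int[distribution P X]_x (kernel_mean k id x ^+ 2)%:E.
  have [] := @dominated_convergence _ _ _ (distribution P X) setT measurableT
    (fun n x => (kernel_mean k (s n) x ^+ 2)%:E) (fun x => (kernel_mean k id x ^+ 2)%:E)
    G => //.
  - move=> n; apply/measurable_EFinP/measurable_funX; exact: measurable_kernel_mean.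
  - apply/measurable_EFinP/measurable_funX; exact: measurable_kernel_mean.
  (* Where [G x] is finite, |y| is integrable under the law [k x], and a second dominated
     convergence, inside the kernel, gives the pointwise limit. *)
  - apply: filterS cond_second_moment_fin_ae => x Gx _.
    apply/cvg_EFin; first exact: nearW.
    rewrite expr2; under eq_fun do rewrite /= expr2.
    suff sm : kernel_mean k (s n) x @[n --> \oo] --> kernel_mean k id x.
      exact: cvgM.
    have iid := id_integrable_kernel Gx.
    have [|||||_ _] := @dominated_convergence _ _ _ (kernel_law k x) setT measurableT
      (fun n y => (s n y)%:E) EFin (fun y => `|y%:E|).
    + by move=> n; exact/measurable_EFinP.
    + exact/measurable_EFinP.
    + by apply: aeW => y _; apply/cvg_EFin; [exact: nearW|exact: scvg].
    + exact: integrable_abse.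
    + by apply: aeW => y n _; rewrite lee_fin sle.
    + by move=> H; apply: fine_cvg; rewrite fineK//; exact: integrable_fin_num.
  - exact: integrable_cond_second_moment.
  - apply: aeW => x n _; rewrite gee0_abs ?lee_fin ?sqr_ge0//.
    exact: kernel_mean_sqr_le.
have E n : \int[P]_w (s n (Y w) * s n (Y' w))%:E =
    \int[distribution P X]_x (kernel_mean k (s n) x ^+ 2)%:E.
  exact: sfun_product_moment.
move: LHS; rewrite (funext E) => LHS.
exact: cvg_unique LHS RHS.
Qed.

End second_moment.

(** * Explained variance in terms of the law of (Y, Y') *)

Section explained_variance_copy.
Context {R : realType} {d : measure_display} {T : measurableType d}.
Context {d' : measure_display} {T' : measurableType d'}.
Variables (P : probability T R) (X : {RV P >-> T'}) (Y : {RV P >-> R}).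
Local Open Scope ereal_scope.
Hypothesis Y2 : (Y : T -> R) \in Lfun P 2%:E.

(** Disintegration is stated for nonnegative functions, so it is applied to the positive and
    negative parts of the identity and the results are subtracted. *)
Lemma is_condexp_kernel_mean (k : R.-pker T' ~> R) :
  is_cond_distribution X Y k -> is_condexp X Y (kernel_mean k id \o X).
Proof.
move=> kY.
have mm : measurable_fun setT (kernel_mean k id) by exact: measurable_kernel_mean.
have iG := integrable_cond_second_moment kY Y2.
have m2 : (kernel_mean k id) \in Lfun (distribution P X) 2%:E.
  apply: Lfun2_of_sqr => //.
  have /integrableP[mG] := iG; apply: le_lt_trans.
  apply: ge0_le_integral => //.
  - by move=> x _; rewrite lee_fin sqr_ge0.
  - exact/measurable_EFinP/measurable_funX.
  - exact: measurableT_comp.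
  - move=> x _; rewrite (le_trans _ (lee_abs _))//; exact: kernel_mean_sqr_le.
apply: is_condexp_comp => //.
  by apply/Lfun1_integrable; rewrite Lfun_subset12 ?fin_num_measure.
move=> A mA.
have mid : measurable_fun setT (EFin : R -> \bar R) by exact/measurable_EFinP.
have iY : P.-integrable setT (EFin \o Y).
  by apply/Lfun1_integrable; rewrite Lfun_subset12 ?fin_num_measure.
have mXA : measurable (X @^-1` A) by exact: measurable_funPTI.
have pE := ge0_integral_cond_distribution kY mA (funepos_ge0 EFin)
  (measurable_funepos mid).
have nE := ge0_integral_cond_distribution kY mA (funeneg_ge0 EFin)
  (measurable_funeneg mid).
have mint (f : R -> \bar R) : (forall y, 0 <= f y) -> measurable_fun setT f ->
  measurable_fun setT (fun x => \int[kernel_law k x]_y f y).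
  move=> f0 mf; apply: measurable_fun_integral_kernel => //.
  by move=> U mU; exact: measurable_kernel.
(* Both parts lie below |y|, so their conditional means integrate to at most E|Y|, and the
   difference of integrals is the integral of the difference. *)
have intpn (f : R -> \bar R) : (forall y, 0 <= f y) -> measurable_fun setT f ->
   (forall y, f y <= `|y|%:E) ->
   (distribution P X).-integrable A (fun x => \int[kernel_law k x]_y f y).
  move=> f0 mf fy; apply: (@integrableS _ _ _ _ setT) => //.
  apply/integrableP; split; first exact: mint.
  under eq_integral do rewrite gee0_abs ?integral_ge0//.
  rewrite -(ge0_integral_cond_distributionT kY)//.
  have /integrableP[_] := iY; apply: le_lt_trans.
  apply: ge0_le_integral => //; first exact: measurableT_comp.
  by apply: measurableT_comp => //; exact/measurable_EFinP.
rewrite [RHS]integralE.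
transitivity (\int[P]_(w in X @^-1` A) (EFin^\+ (Y w)) -
  \int[P]_(w in X @^-1` A) (EFin^\- (Y w))).

2:{ by congr (_ - _); apply: eq_integral => w _; rewrite ?funeposE ?funenegE. }
rewrite pE nE -integralB//; last 2 first.
- apply: intpn => //; first exact: measurable_funepos.
  by move=> y; rewrite funeposE ge_max !lee_fin ler_norm normr_ge0.
- apply: intpn => //; first exact: measurable_funeneg.
  by move=> y; rewrite funenegE ge_max !lee_fin -normrN ler_norm normr_ge0.
apply: ae_eq_integral => //.
- exact/measurable_funTS/measurable_EFinP.
- apply/measurable_funTS/emeasurable_funB; apply: mint => //.
  exact: measurable_funepos.
  exact: measurable_funeneg.
(* A finite conditional second moment makes the identity integrable under the conditional law, so
   the default value of [fine] in [kernel_mean] does not occur. *)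
apply: filterS (cond_second_moment_fin_ae kY Y2) => x Gx _.
by rewrite /kernel_mean fineK ?integrable_fin_num ?id_integrable_kernel// -integralE.
Qed.

(** The variance of E(Y|X) is E(E(Y|X)^2) - (E Y)^2, with first term E(Y Y'). The equality in law is
    recorded too, since it carries moment bounds from [Y] over to [Y']. *)
Lemma explained_variance_copyE (Y' : {RV P >-> R}) : cond_indep_copy P X Y Y' ->
  [/\ (forall f : R -> \bar R, (forall y, 0 <= f y) -> measurable_fun setT f ->
       \int[P]_w f (Y' w) = \int[P]_w f (Y w)),
      (Y' : T -> R) \in Lfun P 2%:E &
    explained_variance P X Y =
    ((fine 'E_P[Y \* Y'] - fine 'E_P[Y] ^+ 2) /
     (fine 'E_P[Y ^+ 2] - fine 'E_P[Y] ^+ 2))%R].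
Proof.
move=> /cond_indep_copy_joint_law[k [kY kY' YY'k]].
have law f : (forall y, 0 <= f y) -> measurable_fun setT f ->
    \int[P]_w f (Y' w) = \int[P]_w f (Y w).
  move=> f0 mf.
  by rewrite (ge0_integral_cond_distributionT kY)// (ge0_integral_cond_distributionT kY').
have Y'2 : (Y' : T -> R) \in Lfun P 2%:E.
  apply: Lfun2_of_sqr => //.
  rewrite (law (fun y => (y ^+ 2)%:E)); last 2 first.
  - by move=> y; rewrite lee_fin sqr_ge0.
  - by apply/measurable_EFinP; exact: exprn_measurable.
  have /integrableP[_] := Lfun2_integrable_sqr Y2; apply: le_lt_trans.
  by under [leRHS]eq_integral do rewrite /= ger0_norm ?sqr_ge0//.
split => //.
have YE := is_condexp_kernel_mean kY.
have Zae := condexp_ae YE.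
have YZ := is_condexp_condexp YE.
set Z := condexp X Y in Zae YZ *.
have mZ : measurable_fun setT Z := is_condexp_measurable YZ.
have mm : measurable_fun setT (kernel_mean k id) by exact: measurable_kernel_mean.
have Z2E : \int[P]_w (Z w ^+ 2)%:E = \int[P]_w (Y w * Y' w)%:E.
  rewrite (product_moment kY Y2 kY' Y'2 YY'k).
  rewrite ge0_integral_distribution//=; last 2 first.
  - exact/measurable_EFinP/measurable_funX.
  - by move=> x; rewrite lee_fin sqr_ge0.
  apply: ae_eq_integral => //.
  - exact/measurable_EFinP/measurable_funX.
  - exact/measurable_EFinP/measurable_funX/measurableT_comp.
  - by apply: filterS Zae => w ->.
have YY'1 : (Y \* Y' : T -> R)%R \in Lfun P 1 by exact: Lfun2_mul_Lfun1.
have Z2 : Z \in Lfun P 2%:E.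
  apply: Lfun2_of_sqr => //; rewrite Z2E.
  by rewrite ltey_eq integrable_fin_num//; exact/Lfun1_integrable.
have EZ : 'E_P[Z] = 'E_P[Y].
  by have [_ _ /(_ setT measurableT)] := YZ; rewrite preimage_setT unlock.
have EZ2 : 'E_P[(Z ^+ 2)%R] = 'E_P[(Y \* Y')%R].
  by rewrite unlock -Z2E.
have Y1 : (Y : T -> R) \in Lfun P 1 by rewrite Lfun_subset12 ?fin_num_measure.
have EY := expectation_fin_num Y1.
have EYY' := expectation_fin_num YY'1.
have EY2 : 'E_P[((Y : T -> R) ^+ 2)%R] \is a fin_num.
  by apply: expectation_fin_num; exact: Lfun2_mul_Lfun1.
(* All expectations involved are finite, so [fine] commutes with the subtractions. *)
rewrite /explained_variance !varianceE// EZ EZ2.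
by rewrite -(fineK EY) -(fineK EYY') -(fineK EY2) -!EFin_expe -!EFinB.
Qed.

End explained_variance_copy.

(** * Continuous truncation *)

Section clip.
Context {R : realType}.
Implicit Types M x : R.

Definition clip M x := Num.max (- M) (Num.min M x).

Lemma clip_le M x : 0 <= M -> `|clip M x| <= M.
Proof.
move=> M0; rewrite /clip; case: (leP M x); case: (leP (- M)) => *;
  by rewrite ler_norml; lra.
Qed.

Lemma clip_id M x : `|x| <= M -> clip M x = x.
Proof.
by rewrite /clip ler_norml => /andP[? ?]; case: (leP M x); case: (leP (- M)); lra.
Qed.

Lemma clip_le_norm M x : 0 <= M -> `|clip M x| <= `|x|.
Proof.
move=> M0; rewrite /clip.
by case: (leP M x); case: (leP (- M)); case: (ler0P x) => *; rewrite ?ler_norml; lra.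
Qed.

Lemma clip_dist M x : 0 <= M -> `|x - clip M x| <= `|x|.
Proof.
move=> M0; rewrite /clip.
by case: (leP M x); case: (leP (- M)); case: (ler0P x) => *; rewrite ?ler_norml; lra.
Qed.

Lemma clip_lipschitz M x y : `|clip M x - clip M y| <= `|x - y|.
Proof.
rewrite /clip; case: (leP M x); case: (leP M y) => *; case: (ler0P (x - y)) => ?;
  repeat case: (leP (- M)) => ?; by rewrite ler_norml; lra.
Qed.

Lemma continuous_clip M : continuous (clip M).
Proof.
move=> x; apply/cvgrPdist_lt => e e0; near=> y.
exact: (le_lt_trans (clip_lipschitz _ _ _)).
Unshelve. all: by end_near. Qed.

(** The left-hand side vanishes for |x| <= M; beyond, it is at most |x|, and (|x| / M)^e >= 1. *)
Lemma clip_dist_powR M x (e : R) : 0 < M -> 0 < e ->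
  `|x - clip M x| <= M `^ (- e) * `|x| `^ (1 + e).
Proof.
move=> M0 e0; have [xM|Mx] := leP `|x| M.
  by rewrite clip_id// subrr normr0 mulr_ge0// powR_ge0.
rewrite (le_trans (clip_dist _ (ltW M0)))//.
have x0 : 0 < `|x| := lt_trans M0 Mx.
rewrite powRD; last by rewrite (gt_eqF x0) implybT.
rewrite powRr1// mulrCA ler_peMr//.
rewrite powRN mulrC ler_pdivlMr ?powR_gt0// mul1r.
by rewrite ge0_ler_powR ?nnegrE// ltW.
Qed.

End clip.

(** * Convergence of expectations under a uniform moment bound *)

Section expectation_limit.
Context {R : realType}.

Lemma measurable_Lfun {d} {T : measurableType d} (Q : probability T R)
    (p : \bar R) (f : T -> R) : f \in Lfun Q p -> measurable_fun setT f.
Proof. by move=> /sub_Lfun_mfun; rewrite inE. Qed.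

Lemma expectation_dist_le {d} {T : measurableType d} (Q : probability T R)
    (f h b : T -> R) (c : R) :
  f \in Lfun Q 1 -> h \in Lfun Q 1 -> measurable_fun setT b ->
  (forall w, `|f w - h w| <= b w) -> (\int[Q]_w (b w)%:E <= c%:E)%E ->
  `|fine 'E_Q[f] - fine 'E_Q[h]| <= c.
Proof.
move=> f1 h1 mb fhb bc.
have fh1 : f \- h \in Lfun Q 1 by rewrite rpredB.
rewrite -lee_fin -abse_EFin EFinB !fineK ?expectation_fin_num//.
rewrite -expectationB// unlock.
have mfh : measurable_fun setT (EFin \o (f \- h)).
  exact/measurable_EFinP/(measurable_Lfun fh1).
apply: le_trans bc; apply: (le_trans (le_abse_integral _ _ mfh)) => //.
apply: ge0_le_integral => //.
- exact: measurableT_comp.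
- exact/measurable_EFinP.
- by move=> w _; rewrite lee_fin fhb.
Qed.

(** The error of clipping [g] at level m is at most m^(-e) * C for all n at once, and the clipped
    function is continuous and bounded, so convergence in distribution handles its expectation. *)
Lemma cvg_expectation_of_moment {S : topologicalType}
  {dn : nat -> measure_display} {Tn : forall n, measurableType (dn n)}
  (Pn : forall n, probability (Tn n) R) (Zn : forall n, Tn n -> S)
  {d : measure_display} {T : measurableType d}
  (P : probability T R) (Z : T -> S) (g : S -> R) (e C : R) :
  cvg_in_distribution Pn Zn P Z -> continuous g -> 0 < e ->
  (forall n, (g \o Zn n) \in Lfun (Pn n) 1) -> (g \o Z) \in Lfun P 1 ->
  (forall n, \int[Pn n]_w (`|g (Zn n w)| `^ (1 + e))%:E <= C%:E)%E ->
  fine 'E_(Pn n)[g \o Zn n] @[n --> \oo] --> fine 'E_P[g \o Z].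
Proof.
move=> ZnZ cg e0 gn1 g1 gC.
have C0 : 0 <= C.
  rewrite -lee_fin; apply: le_trans (gC 0%N).
  by apply: integral_ge0 => w _; rewrite lee_fin powR_ge0.
have clip1 d0 (T0 : measurableType d0) (Q : probability T0 R) (f : T0 -> R) M :
    0 <= M -> f \in Lfun Q 1 -> clip M \o f \in Lfun Q 1.
  move=> M0 f1; apply/Lfun1_integrable.
  have mf : measurable_fun setT f by exact: measurable_Lfun f1.
  apply: (@probability_bounded_integrable _ _ _ _ _ M).
    apply: measurableT_comp => //.
    exact: continuous_measurable_fun (@continuous_clip _ M).
  by move=> w; exact: clip_le.
(* The limit carries no bound of order 1 + e; here the clipping error is controlled by dominated
   convergence. *)
have clipZ : fine 'E_P[clip m%:R \o (g \o Z)] @[m --> \oo] --> fine 'E_P[g \o Z].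
  have mg : measurable_fun setT (g \o Z) by exact: measurable_Lfun g1.
  have [|||||_ _] := @dominated_convergence _ _ _ P setT measurableT
    (fun m w => (clip m%:R (g (Z w)))%:E) (fun w => (g (Z w))%:E)
    (fun w => `|(g (Z w))%:E|)%E.
  - move=> m; apply/measurable_EFinP/measurableT_comp => //.
    exact: continuous_measurable_fun (@continuous_clip _ _).
  - exact/measurable_EFinP.
  - apply: aeW => w _; apply: cvg_near_cst.
    near=> m; rewrite clip_id//.
    by near: m; exact: nbhs_infty_ger.
  - by apply: integrable_abse; exact/Lfun1_integrable.
  - by apply: aeW => w m _; rewrite lee_fin clip_le_norm.
  move=> H; apply: fine_cvg; rewrite fineK ?expectation_fin_num//.
  by rewrite unlock.
apply/cvgrPdist_lt => eps eps0.
have eps3 : 0 < eps / 3 by rewrite divr_gt0.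
have [m [m0 mC mZ]] : exists m : nat, [/\ (0 < m)%N,
    m%:R `^ (- e) * C < eps / 3 &
    `|fine 'E_P[g \o Z] - fine 'E_P[clip m%:R \o (g \o Z)]| < eps / 3].
  have /cvgrPdist_lt/(_ _ eps3) := clipZ => clipZ'.
  near \oo => m; exists m.
  have m0 : (0 < m)%N by near: m; exact: nbhs_infty_gt.
  split => //; last by near: m.
  (* With this [K], eps / 3 * K = C + eps / 3 exceeds [C]; taking m at least K^(1/e) makes m^e at
     least [K]. *)
  pose K := 3 * C / eps + 1.
  have K0 : 0 < K by rewrite /K ltr_wpDl// divr_ge0 ?mulr_ge0// ltW.
  have Km : K <= m%:R `^ e.
    have -> : K = (K `^ e^-1) `^ e by rewrite -powRrM mulVf ?gt_eqF// powRr1// ltW.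
    rewrite ge0_ler_powR ?nnegrE ?powR_ge0 ?(ltW e0)//.
    by near: m; exact: nbhs_infty_ger.
  rewrite powRN mulrC ltr_pdivrMr; last by rewrite (lt_le_trans K0).
  rewrite (@lt_le_trans _ _ (eps / 3 * K))//; last by rewrite ler_pM2l.
  rewrite /K mulrDr mulr1 mulrA; have -> : eps / 3 * (3 * C) / eps = C.
    by field; rewrite gt_eqF.
  by rewrite ltrDl.
have M0 : (0 : R) < m%:R by rewrite ltr0n.
have clipn : fine 'E_(Pn n)[clip m%:R \o (g \o Zn n)] @[n --> \oo]
   --> fine 'E_P[clip m%:R \o (g \o Z)].
  apply: fine_cvg; rewrite fineK; last by apply: expectation_fin_num; exact: clip1.
  apply: (ZnZ (clip m%:R \o g)).
    by move=> x; apply: continuous_comp; [exact: cg|exact: continuous_clip].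
  by exists m%:R => s; rewrite clip_le// ltW.
have /cvgrPdist_lt/(_ _ eps3) := clipn.
apply: filterS => n clipnm.
have gnm : `|fine 'E_(Pn n)[g \o Zn n] -
    fine 'E_(Pn n)[clip m%:R \o (g \o Zn n)]| < eps / 3.
  apply: le_lt_trans mC.
  have mg : measurable_fun setT (g \o Zn n) by exact: measurable_Lfun (gn1 n).
  have mp : measurable_fun setT (fun w => `|g (Zn n w)| `^ (1 + e)).
    apply: (measurableT_comp (measurable_powR _)) => //.
    exact: measurableT_comp mg.
  apply: (@expectation_dist_le _ _ _ _ _
    (fun w => m%:R `^ (- e) * `|g (Zn n w)| `^ (1 + e))) => //.
  - by rewrite clip1// ltW.
  - exact: measurable_funM.
  - by move=> w; exact: clip_dist_powR.
  - under eq_integral do rewrite EFinM.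
    rewrite ge0_integralZl//; last exact/measurable_EFinP.
    by rewrite EFinM lee_wpmul2l// lee_fin powR_ge0.
set a := fine _ in mZ *; set b := fine _ in mZ clipnm; set c := fine _ in clipnm gnm.
set a' := fine _ in gnm *.
(* Clipping error of the limit, distance of the clipped expectations, clipping error at [n]: each is
   below eps / 3. *)
have -> : a - a' = (a - b) + (b - c) + - (a' - c) by ring.
rewrite (le_lt_trans (ler_normD _ _))// normrN (splitr eps).
rewrite (le_lt_trans (lerD (ler_normD _ _) (lexx _)))//; lra.
Unshelve. all: by end_near. Qed.

End expectation_limit.

(** * Passage to the limit in the explained variance *)

(** A nonnegative function with zero integral vanishes almost surely; applied to the squared
    deviation from the mean, this would make [Y] constant. *)
Lemma nondegenerate_variance_neq0 {R : realType} {d} {T : measurableType d}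
    (P : probability T R) (Y : {RV P >-> R}) :
  nondegenerate_RV P Y -> 'V_P[Y] != 0%E.
Proof.
move=> ndY; apply/eqP => V0; apply: ndY; exists (fine 'E_P[Y]).
have mYc : measurable_fun setT (fun w => ((Y w - fine 'E_P[Y]) ^+ 2)%:E).
  by apply/measurable_EFinP/measurable_funX; exact: measurable_funB.
have : (\int[P]_w `|((Y w - fine 'E_P[Y]) ^+ 2)%:E| = 0)%E.
  have EE (f : T -> R) : ('E_P[f] = \int[P]_w (f w)%:E)%E by rewrite unlock.
  rewrite -[RHS]V0 /variance covariance.unlock [RHS]EE; apply: eq_integral => w _.
  by rewrite gee0_abs ?lee_fin ?sqr_ge0// expr2 !fctE.
move/(ae_eq_integral_abs _ measurableT mYc); apply: filterS => w /(_ I)[/eqP].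
by rewrite sqrf_eq0 subr_eq0 => /eqP.
Qed.

Lemma measurable_normr_powR {R : realType} {d} {T : measurableType d}
    (f : T -> R) (r : R) : measurable_fun setT f ->
  measurable_fun setT (fun w => (`|f w| `^ r)%:E).
Proof.
move=> mf; apply/measurable_EFinP/(measurableT_comp (measurable_powR _)).
exact: measurableT_comp.
Qed.

Theorem corollary4p2 (R : realType)
  (dn : nat -> measure_display) (Tn : forall n : nat, measurableType (dn n))
  (Pn : forall n : nat, probability (Tn n) R) (pn : nat -> nat)
  (Xn : forall n : nat, {RV (Pn n) >-> (pn n).-tuple R})
  (Yn Yn' : forall n : nat, {RV (Pn n) >-> R})
  (d : measure_display) (T : measurableType d) (P : probability T R) (p : nat)
  (X : {RV P >-> p.-tuple R}) (Y Y' : {RV P >-> R})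
  (sqYn : forall n : nat, (Yn n : Tn n -> R) \in Lfun (Pn n) 2%:E)
  (sqY : (Y : T -> R) \in Lfun P 2%:E)
  (ndYn : forall n : nat, nondegenerate_RV (Pn n) (Yn n))
  (ndY : nondegenerate_RV P Y)
  (copyYn : forall n : nat, cond_indep_copy (Pn n) (Xn n) (Yn n) (Yn' n))
  (copyY : cond_indep_copy P X Y Y')
  (cvgYY' : cvg_in_distribution Pn (fun n w => (Yn n w, Yn' n w))
              P (fun w => (Y w, Y' w)))
  (momYn : exists2 e : R, 0 < e &
     (ereal_sup (range (fun n : nat =>
        'E_(Pn n)[(fun w => `|Yn n w| `^ (2 + e))%R])) < +oo)%E) :
  explained_variance (Pn n) (Xn n) (Yn n) @[n --> \oo] -->
    explained_variance P X Y.
Proof.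
case: momYn => e e0 sup_lty.
pose m (y : R) := `|y| `^ (2 + e).
have m0 y : 0 <= m y by exact: powR_ge0.
have mm : measurable_fun setT m.
  by apply: (measurableT_comp (measurable_powR _)) => //; exact: measurableT_comp.
have mmE : measurable_fun setT (EFin \o m) by exact/measurable_EFinP.
(* The order 1 + e / 2 used below is half of the order 2 + e in the hypothesis. *)
have mE y : (`|y| `^ (1 + e / 2)) ^+ 2 = m y.
  by rewrite -powR_mulrn ?powR_ge0// -powRrM; congr (_ `^ _); field.
have [C momC] : exists C : R, forall n, (\int[Pn n]_w (m (Yn n w))%:E <= C%:E)%E.
  move: sup_lty; set s := ereal_sup _ => s_lty; exists (fine s) => n.
  have sn : (\int[Pn n]_w (m (Yn n w))%:E <= s)%E.
    by apply: ereal_sup_ubound; exists n => //; rewrite unlock.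
  rewrite fineK// ge0_fin_numE//; apply: le_trans sn.
  by apply: integral_ge0 => w _; rewrite lee_fin m0.
have copyE n := explained_variance_copyE (sqYn n) (copyYn n).
have [_ sqY' ->] := explained_variance_copyE sqY copyY.
have sqYn' n : (Yn' n : Tn n -> R) \in Lfun (Pn n) 2%:E by case: (copyE n).
have momC' n : (\int[Pn n]_w (m (Yn' n w))%:E <= C%:E)%E.
  by have [law _ _] := copyE n; rewrite (law (EFin \o m)).
have int_m n (Z : Tn n -> R) : measurable_fun setT Z ->
    measurable_fun setT (fun w => (m (Z w))%:E).
  by move=> mZ; apply/measurable_EFinP; exact: measurableT_comp mm mZ.
have e2 : 0 < e / 2 by rewrite divr_gt0.
have cvgEYY' : fine ('E_(Pn n)[(Yn n \* Yn' n)%R])%E @[n --> \oo] -->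
    fine ('E_P[(Y \* Y')%R])%E.
  apply: (@cvg_expectation_of_moment _ _ _ _ _ _ _ _ _ _
    (fun z : R * R => z.1 * z.2) (e / 2) (C + C) cvgYY') => //.
  - by move=> z; apply: cvgM; [exact: cvg_fst|exact: cvg_snd].
  - by move=> n; exact: Lfun2_mul_Lfun1.
  - exact: Lfun2_mul_Lfun1.
  - move=> n; rewrite EFinD.
    apply: (@le_trans _ _ (\int[Pn n]_w ((m (Yn n w))%:E + (m (Yn' n w))%:E))%E).
      apply: ge0_le_integral => //.
      - by apply: measurable_normr_powR; exact: measurable_funM.
      - by apply: emeasurable_funD; exact: int_m.
      move=> w _; rewrite -EFinD lee_fin /= normrM powRM// -!mE.
      (* The constant [C + C] comes from a b <= a^2 + b^2, whose two squares are the moments of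
         order 2 + e. *)
      set a := _ `^ _; set b := _ `^ _.
      have := sqr_ge0 (a - b); have := sqr_ge0 (a + b); nra.
    rewrite ge0_integralD//; first by rewrite leeD.
    - by move=> w _; rewrite lee_fin m0.
    - exact: int_m.
    - by move=> w _; rewrite lee_fin m0.
    - exact: int_m.
have cvgEY2 : fine ('E_(Pn n)[((Yn n : Tn n -> R) ^+ 2)%R])%E @[n --> \oo] -->
    fine ('E_P[((Y : T -> R) ^+ 2)%R])%E.
  apply: (@cvg_expectation_of_moment _ _ _ _ _ _ _ _ _ _
    (fun z : R * R => z.1 ^+ 2) (e / 2) C cvgYY') => //.
  - by move=> z; apply: cvgM; exact: cvg_fst.
  - by move=> n; exact: Lfun2_mul_Lfun1.
  - exact: Lfun2_mul_Lfun1.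
  (* The power 1 + e / 2 of y^2 is |y|^(2 + e), so [C] itself is the bound. *)
  - move=> n; under eq_integral do rewrite /= expr2 normrM powRM// -expr2 mE.
    exact: momC.
have Yn1 n : (Yn n : Tn n -> R) \in Lfun (Pn n) 1.
  by apply: Lfun_subset12; [exact: fin_num_measure|exact: sqYn].
have Y1 : (Y : T -> R) \in Lfun P 1.
  by apply: Lfun_subset12 => //; exact: fin_num_measure.
have cvgEY : fine ('E_(Pn n)[Yn n])%E @[n --> \oo] --> fine ('E_P[Y])%E.
  apply: (@cvg_expectation_of_moment _ _ _ _ _ _ _ _ _ _
    (fun z : R * R => z.1) (e / 2) (1 + C) cvgYY') => //.
  - move=> z; exact: cvg_fst.
  - move=> n; rewrite EFinD.
    apply: (@le_trans _ _ (\int[Pn n]_w (1%:E + (m (Yn n w))%:E))%E).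
      apply: ge0_le_integral => //.
      - exact: measurable_normr_powR.
      - by apply: emeasurable_funD => //; exact: int_m.
      move=> w _; rewrite -EFinD lee_fin /= -mE.
      (* The constant [1 + C] comes from a <= 1 + a^2. *)
      set a := _ `^ _; have := sqr_ge0 (a - 1); have := sqr_ge0 a; nra.
    rewrite ge0_integralD//.
    - by rewrite integral_cst// [X in (_ * X)%E]probability_setT mule1 leeD.
    - by move=> w _; rewrite lee_fin m0.
    - exact: int_m.
have VY0 : fine ('E_P[((Y : T -> R) ^+ 2)%R])%E - fine ('E_P[Y])%E ^+ 2 != 0.
  have := nondegenerate_variance_neq0 ndY.
  have EY : ('E_P[Y] \is a fin_num)%E.
    exact: expectation_fin_num.
  have EY2 : ('E_P[((Y : T -> R) ^+ 2)%R] \is a fin_num)%E.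
    by apply: expectation_fin_num; exact: Lfun2_mul_Lfun1.
  by rewrite varianceE// -(fineK EY) -(fineK EY2) -EFin_expe -EFinB eqe.
under eq_fun => n do have [_ _ ->] := copyE n.
apply: cvgM.
  apply: cvgB => //; exact: cvgM.
apply: cvgV => //.
apply: cvgB => //; exact: cvgM.
Qed.
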